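(* Let $P_\lambda=P_{\mathrm{SCAD},\lambda}$ with parameters $a>1$, $\lambda>0$. (a) The minimization problem $$\min_{\beta\in\Lambda}\ \mathcal L(\beta)=\tfrac12\beta^\top Q\beta+q^\top\beta+n\sum_{i=1}^d P_\lambda(|\beta_i|)$$ is equivalent to the program $$\min_{\beta\in\Lambda,\ g\in[0,\lambda]^d}\ \mathcal F_{\mathrm{SCAD}}(\beta,g),$$ i.e. $\beta$ is a global minimizer of the first problem if and only if there exists $g\in[0,\lambda]^d$ such that $(\beta,g)$ is a global minimizer of the second problem. (b) For any $\theta\ge 0$, the first derivative of the SCAD penalty can be written as $$P_\lambda'(\theta)=\operatorname*{argmin}_{\kappa\in[0,\lambda]}\Big\{(\theta-a\lambda)\cdot\kappa+\tfrac12(a-1)\cdot\kappa^2\Big\}.$$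
   Context: Setting: $n\ge1$ is the sample size, $d\ge 1$ the dimension, $0\le m<d$; $Q\in\mathbb R^{d\times d}$ is symmetric (not necessarily positive semidefinite), $q\in\mathbb R^d$, $\mathcal A\in\mathbb R^{d\times m}$ has full rank, $\mathbf b\in\mathbb R^m$, and $\Lambda:=\{\beta\in\mathbb R^d:\mathcal A^\top\beta\le\mathbf b\}$ is nonempty. It is assumed that the problem $\min_{\beta\in\Lambda}\mathcal L(\beta)$ has a finite global solution. SCAD penalty: for $a>1$, $\lambda>0$ and $\theta\ge0$, $$P_{\mathrm{SCAD},\lambda}(\theta):=\int_0^\theta\lambda\Big\{\mathbb I(t\le\lambda)+\frac{(a\lambda-t)_+}{(a-1)\lambda}\mathbb I(t>\lambda)\Big\}\,dt,$$ where $\mathbb I$ is the indicator function and $(b)_+=\max\{b,0\}$. At $\theta=0$, $P_\lambda'$ denotes the right derivative. For $\beta=(\beta_i),g=(g_i)\in\mathbb R^d$, $$\mathcal F_{\mathrm{SCAD}}(\beta,g):=\tfrac12\beta^\top Q\beta+q^\top\beta+n\sum_{i=1}^d\Big\{(|\beta_i|-a\lambda)g_i+\tfrac12(a-1)g_i^2\Big\}.$$ *)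

(* Defs.v *)
From mathcomp Require Export all_boot all_order all_algebra.
From mathcomp Require Export all_classical all_reals all_analysis.

Set Implicit Arguments.
Unset Strict Implicit.
Unset Printing Implicit Defensive.

Export Order.TTheory GRing.Theory Num.Theory numFieldNormedType.Exports.

Local Open Scope classical_set_scope.
Local Open Scope ring_scope.

Definition argmin (R : realType) (T : Type) (S : set T) (f : T -> R) : set T :=
  [set x | S x /\ forall y, S y -> f x <= f y].

Definition scad_integrand (R : realType) (a lam t : R) : R :=
  lam * ((t <= lam)%R%:R
         + Num.max (a * lam - t) 0 / ((a - 1) * lam) * (lam < t)%R%:R).

(* Only the values at theta >= 0 are meaningful; for theta < 0 the domain of
   integration is empty and the value is 0. *)
Definition scad (R : realType) (a lam theta : R) : R :=
  \int[lebesgue_measure]_(t in `[0, theta]) scad_integrand a lam t.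

Definition right_quotient (R : realType) (f : R -> R) (x h : R) : R :=
  h^-1 * (f (x + h) - f x).

(* Differentiation of a function on the half-line [0, +oo[: two-sided at
   interior points, one-sided (from the right) at 0. *)
Definition half_line_derivable (R : realType) (f : R -> R) (x : R) : Prop :=
  if x == 0 then cvg (right_quotient f 0 h @[h --> 0^'+]) else derivable f x 1.

Definition half_line_derive (R : realType) (f : R -> R) (x : R) : R :=
  if x == 0 then lim (right_quotient f 0 h @[h --> 0^'+]) else derive1 f x.

Definition polyhedron (R : realType) (d m : nat) (A : 'M[R]_(d, m))
    (b : 'cV[R]_m) : set 'cV[R]_d :=
  [set beta : 'cV[R]_d | forall j, (A^T *m beta) j 0 <= b j 0].

Definition box (R : realType) (d : nat) (lam : R) : set 'cV[R]_d :=
  [set g : 'cV[R]_d | forall i, 0 <= g i 0 <= lam].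

Definition quadratic (R : realType) (d : nat) (Q : 'M[R]_d) (q beta : 'cV[R]_d)
    : R :=
  2^-1 * (beta^T *m Q *m beta) 0 0 + (q^T *m beta) 0 0.

Definition scad_loss (R : realType) (n d : nat) (Q : 'M[R]_d) (q : 'cV[R]_d)
    (a lam : R) (beta : 'cV[R]_d) : R :=
  quadratic Q q beta + n%:R * \sum_(i < d) scad a lam `|beta i 0|.

Definition F_scad (R : realType) (n d : nat) (Q : 'M[R]_d) (q : 'cV[R]_d)
    (a lam : R) (beta g : 'cV[R]_d) : R :=
  quadratic Q q beta
  + n%:R * \sum_(i < d) ((`|beta i 0| - a * lam) * g i 0
                         + 2^-1 * (a - 1) * g i 0 ^+ 2).

(* Main.v *)
Require Import Defs.
From mathcomp Require Import all_boot all_order all_algebra.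
From mathcomp Require Import all_classical all_reals all_analysis.
From mathcomp Require Import ring lra.

Import Order.TTheory GRing.Theory Num.Theory.

Local Open Scope classical_set_scope.
Local Open Scope ring_scope.

(** The SCAD penalty is, up to an additive constant, the lower envelope of the
    functions [theta |-> (theta - a * lam) * kappa + (a - 1) / 2 * kappa ^ 2],
    affine in [theta], for [kappa] in [[0, lam]]; this exhibits it
    as a concave function of [theta].

    For fixed [theta] the expression is a strictly convex parabola in [kappa]
    with vertex [(a * lam - theta) / (a - 1)], so its only minimizer on
    [[0, lam]] is the projection of that vertex onto the interval. This
    projection is exactly the integrand that defines the penalty
    ([scad_integrandE], [scad_kernel_gap]).

    The envelope lies below each of the affine functions and touches the one of
    slope [scad_integrand theta] at [theta]. A function with such a continuous
    choice of supporting slopes is differentiable with that slope as derivative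
    ([supergradient_quotient_cvg]), so the fundamental theorem of calculus
    identifies the penalty with the envelope on the half-line ([scadE]). The
    derivative formula follows, including the one-sided derivative at the
    origin.

    For the two programs: minimizing the joint objective over [g] alone separates
    over coordinates and returns the penalized loss up to a constant, and
    minimizing jointly is the same as minimizing the partial minimum
    ([argmin_partial]). *)

(** * Joint and partial minimization *)

(** Replacing the second component of any feasible pair [(x, y)] by the optimal
    response [s x] keeps the pair feasible and does not increase the objective,
    so only the pairs [(x, s x)] compete, and on these the objective is
    [f x - c]. *)
Lemma argmin_partial (R : realType) (T U : Type) (S : set T) (B : set U)
    (f : T -> R) (F : T -> U -> R) (s : T -> U) (c : R) :
  (forall x, B (s x)) -> (forall x, f x = F x (s x) + c) ->
  (forall x y, B y -> F x (s x) <= F x y) ->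
  forall x, argmin S f x <->
    exists2 y, B y &
      argmin [set p : T * U | S p.1 /\ B p.2] (fun p => F p.1 p.2) (x, y).
Proof.
move=> Bs fE Fs x; split.
- move=> [Sx fmin]; exists (s x) => //; split=> [|[x' y'] /= [Sx' By']].
    by split=> /=; [exact: Sx|exact: Bs].
  apply: le_trans (Fs _ _ By').
  by have := fmin _ Sx'; rewrite !fE lerD2r.
- move=> [y By [[/= Sx _] Fmin]]; split=> [//|x' Sx'].
  rewrite !fE lerD2r (le_trans (Fs _ _ By))//.
  by apply: (Fmin (x', s x')); split=> /=; [exact: Sx'|exact: Bs].
Qed.

(** * Functions with a continuous choice of supergradients *)

(** Exchanging the roles of the two points bounds the difference quotient
    between [x] and [x + h] by the slopes [s x] and [s (x + h)]; these have the
    same limit. *)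
Lemma supergradient_quotient_cvg (R : realType) (F s : R -> R) (x : R) :
  (forall x y, F y - F x <= (y - x) * s x) -> {for x, continuous s} ->
  h^-1 * (F (x + h) - F x) @[h --> 0^'] --> s x.
Proof.
move=> Fs cs; apply/cvgrPdist_le => e e0.
have sh : s (x + h) @[h --> 0^'] --> s x.
  apply: cvg_within_filter; apply: continuous_cvg => //.
  rewrite -[X in _ --> X]addr0; apply: cvgD; [exact: cvg_cst|exact: cvg_id].
move/cvgrPdist_le : sh => /(_ _ e0) sh.
near=> h.
have h0 : h != 0 by near: h; exact: nbhs_dnbhs_neq.
have : `|s x - s (x + h)| <= e by near: h.
apply: le_trans.
have up := Fs x (x + h); have dn := Fs (x + h) x.
(* writing the increment as [h * k] reduces both bounds to comparing slopes *)
have [k kE] : exists k, F (x + h) - F x = h * k.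
  by exists (h^-1 * (F (x + h) - F x)); rewrite mulVKf.
rewrite kE mulKf//.
have {}up : h * k <= h * s x by move: up; rewrite kE; lra.
have {}dn : h * s (x + h) <= h * k by move: dn kE; lra.
move: h0; rewrite neq_lt => /orP[h0|h0].
- rewrite !ler_nM2l// in up dn.
  by rewrite ler0_norm ?subr_le0// ler0_norm ?subr_le0//; lra.
- rewrite !ler_pM2l// in up dn.
  by rewrite ger0_norm ?subr_ge0// ger0_norm ?subr_ge0//; lra.
Unshelve. all: by end_near. Qed.

Lemma supergradient_is_derive (R : realType) (F s : R -> R) (x : R) :
  (forall x y, F y - F x <= (y - x) * s x) -> {for x, continuous s} ->
  is_derive x 1 F (s x).
Proof.
move=> Fs cs; have Fq := supergradient_quotient_cvg _ _ _ _ Fs cs.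
have Fd : h^-1 *: ((F \o shift x) (h *: 1) - F x) @[h --> 0^'] --> s x.
  rewrite [X in X @ _](_ : _ = fun h => h^-1 * (F (x + h) - F x))//.
  by apply/funext => h /=; rewrite [h%:A]mulr1 [h + x]addrC.
by apply: DeriveDef; [apply/cvg_ex; exists (s x)|apply: cvg_lim].
Qed.

(** * SCAD penalty as a lower envelope *)

Definition scad_kernel {R : realType} (a lam theta kappa : R) : R :=
  (theta - a * lam) * kappa + 2^-1 * (a - 1) * kappa ^+ 2.

Definition scad_envelope {R : realType} (a lam theta : R) : R :=
  scad_kernel a lam theta (scad_integrand a lam theta).

Section scad_envelope.
Context {R : realType} {a lam : R}.
Hypotheses (ha : 1 < a) (hlam : 0 < lam).

Let s := scad_integrand a lam.

Lemma scad_integrandE t :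
  s t = Num.min lam (Num.max ((a * lam - t) / (a - 1)) 0).
Proof.
have a1 : 0 < a - 1 by rewrite subr_gt0.
have aV : 0 < (a - 1)^-1 by rewrite invr_gt0.
rewrite /s /scad_integrand; case: (leP t lam) => tl /=.
- rewrite mulr0 addr0 mulr1 min_l// le_max ler_pdivlMr//.
  by apply/orP; left; lra.
- rewrite add0r mulr1 min_r; last first.
    by rewrite ge_max (ltW hlam) andbT ler_pdivrMr//; lra.
  rewrite maxr_pMl ?invr_ge0 ?mulr_ge0 ?ltW// mul0r maxr_pMr ?ltW// mulr0.
  by congr Num.max; field; rewrite !gt_eqF.
Qed.

Lemma scad_integrand_itv t : 0 <= s t <= lam.
Proof. by rewrite scad_integrandE le_min ge_min lexx le_max lexx orbT ltW. Qed.

Lemma scad_integrand_continuous : continuous s.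
Proof.
move=> t; have -> : s = (cst lam) \min
    ((fun t => (a * lam - t) / (a - 1)) \max cst 0).
  by apply/funext => u; rewrite scad_integrandE.
apply: continuous_min; first exact: cst_continuous.
apply: continuous_max; last exact: cst_continuous.
apply: cvgMr_tmp; apply: cvgB; [exact: cvg_cst|exact: cvg_id].
Qed.

(** Variational inequality for the projection of the vertex of the parabola onto
    [[0, lam]], combined with strong convexity: it yields both minimality and
    uniqueness. *)
Lemma scad_kernel_gap theta kappa : 0 <= kappa <= lam ->
  2^-1 * (a - 1) * (kappa - s theta) ^+ 2 <=
  scad_kernel a lam theta kappa - scad_kernel a lam theta (s theta).
Proof.
move=> /andP[k0 kl]; have a1 : 0 < a - 1 by rewrite subr_gt0.
set u := (a * lam - theta) / (a - 1).
have uE : theta - a * lam = - ((a - 1) * u) by rewrite /u; field; rewrite gt_eqF.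
have proj : 0 <= (kappa - s theta) * (s theta - u).
  rewrite scad_integrandE -/u; case: (leP u 0) => u0.
    by rewrite (min_r (ltW hlam)) subr0 mulr_ge0//; lra.
  case: (leP lam u) => ul; last by rewrite subrr mulr0.
  by rewrite -mulrNN mulr_ge0//; lra.
rewrite /scad_kernel uE -subr_ge0.
rewrite (_ : _ - _ = (a - 1) * ((kappa - s theta) * (s theta - u))).
  by rewrite mulr_ge0// ltW.
by field.
Qed.

Lemma scad_kernel_min theta kappa : 0 <= kappa <= lam ->
  scad_envelope a lam theta <= scad_kernel a lam theta kappa.
Proof.
move=> /(scad_kernel_gap theta); rewrite -subr_ge0 => gap.
rewrite -subr_ge0 (le_trans _ (_ : 2^-1 * (a - 1) * (kappa - s theta) ^+ 2 <= _))//.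
  by rewrite mulr_ge0 ?sqr_ge0// mulr_ge0 ?invr_ge0// subr_ge0 ltW.
by rewrite -subr_ge0.
Qed.

Lemma scad_kernel_argmin theta :
  argmin `[0, lam] (scad_kernel a lam theta) = [set s theta].
Proof.
apply/seteqP; split=> [k [/= k0l kmin]|_ ->] /=.
- have a1 : 0 < a - 1 by rewrite subr_gt0.
  have sI : `[0, lam]%classic (s theta).
    by rewrite /= in_itv/= scad_integrand_itv.
  rewrite in_itv/= in k0l.
  have gap := scad_kernel_gap theta _ k0l.
  have le0 : 2^-1 * (a - 1) * (k - s theta) ^+ 2 <= 0.
    by apply: le_trans gap _; rewrite subr_le0 kmin.
  apply/eqP; rewrite -subr_eq0 -sqrf_eq0 eq_le sqr_ge0 andbT.
  by rewrite pmulr_rle0 // in le0; rewrite mulr_gt0 ?invr_gt0.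
- split=> [|k]; rewrite /= in_itv/=; first exact: scad_integrand_itv.
  exact: scad_kernel_min.
Qed.

(** The minimizer at [x] is an admissible competitor at [y], and the competitor
    values at the two points differ by [(y - x) * s x]. *)
Lemma scad_envelope_supergradient x y :
  scad_envelope a lam y - scad_envelope a lam x <= (y - x) * s x.
Proof.
have := scad_kernel_min y _ (scad_integrand_itv x).
by rewrite /scad_envelope /scad_kernel -/s; lra.
Qed.

Lemma scad_envelope_is_derive (x : R) :
  is_derive x 1 (scad_envelope a lam) (s x).
Proof.
apply: supergradient_is_derive; first exact: scad_envelope_supergradient.
exact: scad_integrand_continuous.
Qed.

Lemma scadE theta : 0 <= theta ->
  scad a lam theta = scad_envelope a lam theta - scad_envelope a lam 0.
Proof.
rewrite le_eqVlt => /predU1P[<-|theta0].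
  by rewrite /scad set_itv1 Rintegral_set1 subrr.
have dF x := scad_envelope_is_derive x.
have cF : continuous (scad_envelope a lam).
  by move=> x; apply: differentiable_continuous; apply/derivable1_diffP.
rewrite /scad /Rintegral (@continuous_FTC2 _ _ (scad_envelope a lam))//.
- exact: continuous_subspaceT scad_integrand_continuous.
- split.
  + by move=> x _; exact: ex_derive.
  + exact/cvg_at_right_filter/cF.
  + exact/cvg_at_left_filter/cF.
- by move=> x _; rewrite derive1E derive_val.
Qed.

Lemma scad_half_line_derive theta : 0 <= theta ->
  half_line_derivable (scad a lam) theta /\
  half_line_derive (scad a lam) theta = s theta.
Proof.
rewrite /half_line_derivable /half_line_derive le_eqVlt.
case: (eqVneq theta 0) => [->|theta0] /=.
- move=> _.
  suff q : right_quotient (scad a lam) 0 h @[h --> 0^'+] --> s 0.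
    by split; [apply/cvg_ex; exists (s 0)|apply: cvg_lim].
  have := supergradient_quotient_cvg _ _ _ _ scad_envelope_supergradient
    (scad_integrand_continuous 0).
  move=> /cvg_dnbhs_at_right; apply: cvg_trans; apply: near_eq_cvg.
  near=> h.
  have h0 : 0 < h by near: h; exact: nbhs_right_gt.
  by rewrite /right_quotient add0r !scadE ?(ltW h0)// subrr subr0.
- move=> {}theta0.
  have [] : is_derive theta 1 (scad a lam) (s theta).
    have dF : is_derive theta 1
        (scad_envelope a lam \- cst (scad_envelope a lam 0)) (s theta).
      rewrite -[X in is_derive _ _ _ X]subr0.
      by apply: is_deriveB; exact: scad_envelope_is_derive.
    (* penalty and envelope agree on the half-line only, which is a
       neighbourhood of [theta] because [theta] is positive *)
    apply: near_eq_is_derive dF; near=> x.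
    rewrite scadE//; apply: ltW; near: x; exact: lt_nbhsr.
  by rewrite derive1E.
Unshelve. all: by end_near. Qed.

End scad_envelope.

(** * Equivalence of the two programs *)

Theorem proposition2p1 (R : realType) (a lam : R) (ha : 1 < a) (hlam : 0 < lam) :
  (forall (n d m : nat) (Q : 'M[R]_d) (q : 'cV[R]_d)
          (A : 'M[R]_(d, m)) (b : 'cV[R]_m),
     (1 <= n)%N -> (1 <= d)%N -> (m < d)%N ->
     Q^T = Q ->
     \rank A = m ->
     polyhedron A b !=set0 ->
     argmin (polyhedron A b) (scad_loss n Q q a lam) !=set0 ->
     forall beta : 'cV[R]_d,
       argmin (polyhedron A b) (scad_loss n Q q a lam) beta <->
       exists2 g : 'cV[R]_d, box lam g &
         argmin [set p : 'cV[R]_d * 'cV[R]_d | polyhedron A b p.1 /\ box lam p.2]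
                (fun p => F_scad n Q q a lam p.1 p.2) (beta, g))
  /\
  (forall theta : R, 0 <= theta ->
     half_line_derivable (scad a lam) theta /\
     argmin `[0, lam] (fun kappa : R =>
       (theta - a * lam) * kappa + 2^-1 * (a - 1) * kappa ^+ 2)
     = [set half_line_derive (scad a lam) theta]).
Proof.
split=> [n d m Q q A b _ _ _ _ _ _ _ beta|theta theta0].
- pose g (x : 'cV[R]_d) : 'cV[R]_d := \col_i scad_integrand a lam `|x i 0|.
  apply: (argmin_partial _ _ _ _ _ _ (F_scad n Q q a lam) g
    (n%:R * \sum_(i < d) - scad_envelope a lam 0)).
  + by move=> x i; rewrite mxE scad_integrand_itv.
  + move=> x; rewrite /scad_loss /F_scad -[RHS]addrA -mulrDr -big_split/=.
    congr (_ + _ * _); apply: eq_bigr => i _.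
    by rewrite mxE scadE.
  + move=> x y yB; rewrite lerD2l ler_wpM2l//; apply: ler_sum => i _.
    by rewrite mxE; exact: scad_kernel_min.
- have [dP dE] := scad_half_line_derive ha hlam _ theta0.
  by split=> //; rewrite dE -(scad_kernel_argmin ha hlam).
Qed.
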